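(* Let $\Gamma$ be a tree on a finite set $\Pi$ and let $\{\Pi_1,\Pi_2\}$ be a principal decomposition of $\Gamma$, with principal orientation $o_{\Pi_1,\Pi_2}$. Regard $\widetilde{Ord}(\Pi_1)$ as a set of partial orders on $\Pi_1$ as described in the context. Then: 1. $\widetilde{Ord}(\Pi_1)$ equals the set of partial orders $\tilde d$ on $\Pi_1$ such that (i) $\tilde d$ is a rooted tree, (ii) for every $\beta\in\Pi_2$ the restriction of $\tilde d$ to $Nbd(\beta)$ is a total order, and (iii) $\tilde d$ is minimal with respect to (i) and (ii): if a partial order $\tilde f$ on $\Pi_1$ satisfies (i), (ii) and $\tilde f\le\tilde d$, then $\tilde f=\tilde d$. 2. Let $\widetilde{Ord}_{\Pi_1,\Pi_2}(\Pi)$ be the set of partial orders $\tilde e$ on $\Pi$ such that (i) $\tilde e$ is a rooted tree, (ii) $o_{\Pi_1,\Pi_2}\le\tilde e$, i.e. $\alpha<_{\tilde e}\beta$ for every edge $\overline{\alpha\beta}$ with $\alpha\in\Pi_1$, $\beta\in\Pi_2$, (iii) no two distinct elements of $\Pi_2$ are comparable in $\tilde e$, and (iv) $\tilde e$ is minimal with respect to (i), (ii), (iii): if $\tilde f$ satisfies (i)–(iii) and $\tilde f\le\tilde e$ then $\tilde f=\tilde e$. Then the lifting $\tilde d\mapsto\tilde{od}$ is a bijection $\widetilde{Ord}(\Pi_1)\to\widetilde{Ord}_{\Pi_1,\Pi_2}(\Pi)$. 3. The set $\Sigma(o_{\Pi_1,\Pi_2})$ is the disjoint union $$\Sigma(o_{\Pi_1,\Pi_2})=\coprod_{\tilde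 e\in\widetilde{Ord}_{\Pi_1,\Pi_2}(\Pi)}\Sigma(\tilde e).$$
   Context: $\Gamma$ is a tree with vertex set $\Pi$; a principal decomposition is an ordered pair $\{\Pi_1,\Pi_2\}$ with $\Pi=\Pi_1\sqcup\Pi_2$ and no edge inside either $\Pi_i$. The principal orientation $o_{\Pi_1,\Pi_2}$ orients each edge from its $\Pi_1$-endpoint to its $\Pi_2$-endpoint. For a partial order (or acyclic oriented graph, via its transitive closure) $p$ on a set $X$, $\Sigma(p)$ is the set of linear orderings $c$ of $X$ extending $p$ (i.e. $x<_py\Rightarrow x<_cy$). For partial orders, $\tilde f\le\tilde e$ means $x<_{\tilde f}y\Rightarrow x<_{\tilde e}y$. A partial order on a finite set is a rooted tree if it has a unique minimal element (the root) and every other element has exactly one immediate predecessor (equivalently its Hasse diagram is a tree oriented away from the root). For $\beta\in\Pi$, $Nbd(\beta)=\{u\in\Pi\mid\overline{\beta u}$ is an edge of $\Gamma\}$. For a linear ordering $d$ of $\Pi_1$ and $v\in\Pi_1$, $\Gamma_{d,v}$ is the connected component containing $v$ of the subgraph of $\Gamma$ induced on $\Pi\setminus\{w\in\Pi_1\mid w<_dv\}$; $d,d'$ are equivalent if $\Gamma_{d,v}=\Gamma_{d',v}$ for all $v\in\Pi_1$, and $\widetilde{Ord}(\Pi_1)$ is the set of equivalence classes. To the class $\tilde d$ of $d$ one attaches the partial order $\le_{\tilde d}$ on $\Pi_1$ defined by $v'\le_{\tilde d}v$ iff $v\in\Gamma_{d,v'}$; it depends only on $\tilde d$ and determines $\tilde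 d$, so $\widetilde{Ord}(\Pi_1)$ is identified with a set of partial orders on $\Pi_1$. The lifting $\tilde{od}$ of $\tilde d$ is the partial order on $\Pi$ generated (by transitive closure) by $\le_{\tilde d}$ together with the relations $\alpha<\beta$ for all edges $\overline{\alpha\beta}$ with $\alpha\in\Pi_1,\beta\in\Pi_2$ (its Hasse diagram is the reduction of the union of the oriented graphs $o_{\Pi_1,\Pi_2}$ and $\tilde d$).
   Formalization: Item 1 is stated only for nonempty Π_1: if Π_1 is empty (Γ a single vertex of Π_2), the empty order lies in Ord~(Π_1) but has no root, so item 1 as written fails there. *)

(* Defs.v *)
From mathcomp Require Import all_boot.
From mathcomp Require Import boolp classical_sets functions.

Set Implicit Arguments.
Unset Strict Implicit.
Unset Printing Implicit Defensive.

(* Orders are reflexive boolean relations; [slt r] is the strict part of [r]. *)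
Section Orders.
Variable X : finType.
Implicit Types r f e p c : rel X.

Definition partial_order r : Prop :=
  [/\ reflexive r, antisymmetric r & transitive r].

Definition linear_order r : Prop := partial_order r /\ total r.

Definition slt r : rel X := fun x y => (x != y) && r x y.

Definition po_le f e : Prop := forall x y, slt f x y -> slt e x y.

Definition minimal_elt r x : Prop := forall y, ~~ slt r y x.

Definition immediate_pred r y x : Prop :=
  slt r y x /\ forall z, ~~ (slt r y z && slt r z x).

Definition rooted_tree r : Prop :=
  exists root, (forall x, minimal_elt r x <-> x = root) /\
    (forall x, x <> root -> exists! y, immediate_pred r y x).

Definition minimal_order (S : set (rel X)) e : Prop :=
  S e /\ forall f, S f -> po_le f e -> f = e.

Definition Sigma p : set (rel X) :=
  [set c | linear_order c /\ forall x y, slt p x y -> slt c x y]%classic.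

End Orders.

Section Graph.
Variable T : finType.
Variable g : rel T.

(* In [ucycle] the sequences of size at most 2 are the degenerate closed walks
   (a single edge traversed back and forth), hence the bound. *)
Definition is_tree : Prop :=
  [/\ symmetric g, irreflexive g, 0 < #|T|, forall x y, connect g x y
    & forall s : seq T, ucycle g s -> size s <= 2].

Variables P1 P2 : {set T}.

Definition principal_decomposition : Prop :=
  [/\ forall x, (x \in P1) || (x \in P2), [disjoint P1 & P2],
      {in P1 &, forall x y, ~~ g x y} & {in P2 &, forall x y, ~~ g x y}].

Definition orientation : rel T :=
  fun a b => [&& g a b, a \in P1 & b \in P2].

Definition Nbd (b : T) : {set T} := finset (g b).

Local Notation V1 := {x : T | x \in P1}.
Implicit Types (d : rel V1) (v w : V1).

Definition Gamma_vertex d v : pred T :=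
  fun x => ~~ [exists w : V1, (val w == x) && slt d w v].

Definition Gamma d v : {set T} :=
  finset (connect (fun a b => [&& g a b, Gamma_vertex d v a
                                & Gamma_vertex d v b]) (val v)).

Definition ord_equiv d d' : Prop := forall v, Gamma d v = Gamma d' v.

Definition class_order d : rel V1 := fun v' v => val v \in Gamma d v'.

(* The set of [ord_equiv]-classes of linear orderings of P1, each class being
   identified with its partial order; see [class_order_eq]. *)
Definition tOrd : set (rel V1) :=
  [set class_order d | d in [set d | linear_order d]]%classic.

Definition Nbd_total d : Prop :=
  forall b, b \in P2 ->
  forall v w, val v \in Nbd b -> val w \in Nbd b -> d v w || d w v.

(* The order d transported along the inclusion of P1 in T. *)
Definition extend d : rel T :=
  fun x y => [exists v : V1, exists w : V1,
                [&& val v == x, val w == y & d v w]].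

Definition lifting d : rel T :=
  connect (fun x y => extend d x y || orientation x y).

Definition P2_incomparable (e : rel T) : Prop :=
  {in P2 &, forall x y, x != y -> ~~ e x y}.

Definition tOrdP : set (rel T) :=
  [set e | minimal_order
    [set f | [/\ partial_order f, rooted_tree f,
                 forall a b, orientation a b -> slt f a b
               & P2_incomparable f]]%classic e]%classic.

(* [class_order] only depends on the class of d, and determines it. *)
Lemma class_order_eq : principal_decomposition ->
  forall d d', ord_equiv d d' <-> class_order d = class_order d'.
Proof.
move=> [cov dis _ ind2] d d'; split=> [eqG|eqo v].
  by apply/funext=> v'; apply/funext=> v; rewrite /class_order eqG.
have P2vertex c x : x \in P2 -> Gamma_vertex c v x.
  move=> x2; apply/existsPn => w; rewrite negb_and; apply/orP; left.
  apply: contraTneq x2 => <-.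
  by rewrite (disjointFr dis (valP w)).
have sub c c' : class_order c = class_order c' ->
    forall x, x \in Gamma c v -> x \in Gamma c' v.
  move=> eqc x xG; case: (boolP (x \in P1)) => [x1|x1].
    by have /(congr1 (fun r => r v (exist _ x x1))) := eqc;
       rewrite /class_order /= xG => <-.
  have x2 : x \in P2 by move: (cov x); rewrite (negbTE x1).
  move: xG; rewrite inE => /connectP[s].
  case/lastP: s => [_ xE|s z]; first by rewrite xE (valP v) in x1.
  rewrite last_rcons rcons_path => /andP[ps /and3P[guz Gu _]] xz.
  subst z; set u := last _ s in guz Gu.
  have u1 : u \in P1.
    by move: (cov u) => /orP[//|u2]; move: (ind2 _ _ u2 x2); rewrite guz.
  have uG : u \in Gamma c v by rewrite inE; apply/connectP; exists s.
  have uG' : u \in Gamma c' v.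
    by have /(congr1 (fun r => r v (exist _ u u1))) := eqc;
       rewrite /class_order /= uG => <-.
  have Gu' : Gamma_vertex c' v u.
    move: uG'; rewrite inE => /connectP[t].
    case/lastP: t => [_ ->|t z].
      apply/existsPn => w; apply/negP => /andP[/eqP/val_inj ->].
      by rewrite /slt eqxx.
    by rewrite last_rcons rcons_path => /andP[_ /and3P[_ _ Gz]] ->.
  rewrite inE; move: uG'; rewrite inE => /connect_trans; apply.
  apply: connect1.
  by rewrite guz Gu' P2vertex.
by apply/setP => x; apply/idP/idP; apply: sub.
Qed.

End Graph.

Arguments tOrd {T} g P1.

(* Main.v *)
(* If an order [f] on P1 is a rooted tree, total on every Nbd(b), and extended by
   a linear order [d], then [class_order d <= f]: along a path staying
   [d]-above [v], consecutive vertices of P1 are [f]-comparable, so the path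
   stays [f]-above [v]. As [class_order d] itself satisfies both conditions and
   is extended by [d], the class orders are exactly the minimal such orders.
   Restriction to P1 sends the orders on T satisfying (i)-(iii) of part 2 to
   such orders, and lifting goes back, so that a minimal order [e] on T is the
   lifting of [class_order] of the restriction to P1 of any linear extension of
   [e]. This gives surjectivity of the lifting and disjointness of the union. *)
Require Import Defs.
From mathcomp Require Import all_boot.
From mathcomp Require Import boolp classical_sets functions.

Set Implicit Arguments.
Unset Strict Implicit.
Unset Printing Implicit Defensive.

(** * Rooted trees and linear extensions of finite orders *)

Section FiniteOrders.
Variable X : finType.
Implicit Types r f e : rel X.

Definition height r x := #|[set y | r y x]%SET|.

Lemma height_lt r x y : partial_order r -> slt r x y -> height r x < height r y.
Proof.
move=> [rr ra rt] /andP[nxy xy]; apply: proper_card; apply/properP; split.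
  by apply/fintype.subsetP => z; rewrite !inE => /rt; apply.
exists y; rewrite !inE ?rr //; apply: contra nxy => yx.
by apply/eqP/ra; rewrite xy.
Qed.

(** Take [p] of maximal height among the elements above [a] and strictly below [x]. *)
Lemma exists_immediate_pred r a x : partial_order r -> slt r a x ->
  exists2 p, immediate_pred r p x & r a p.
Proof.
move=> rpo ax; have [rr ra rt] := rpo.
pose P p := r a p && slt r p x.
have Pa : P a by rewrite /P rr.
case: (arg_maxnP (height r) Pa) => p /andP[ap px] pmax.
exists p => //; split=> // z; apply/negP => /andP[pz zx].
have /pmax : P z by rewrite /P zx (rt _ _ _ ap) //; case/andP: pz.
by apply/negP; rewrite -ltnNge; apply: height_lt.
Qed.

(* Directedness replaces the root so that the empty order on an empty P1 is not
   a special case. *)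
Definition tree_order r :=
  (forall x y z, r x z -> r y z -> r x y || r y x) /\
  (forall x y, exists z, r z x && r z y).

(** Forward, by induction on height: all elements strictly below [z] lie below its unique immediate
    predecessor. Backward, directedness puts an element of least height below all others, and the
    chain condition makes two immediate predecessors comparable, hence equal. *)
Lemma rooted_treeP r : partial_order r ->
  rooted_tree r <-> inhabited X /\ tree_order r.
Proof.
move=> rpo; have [rr ra rt] := rpo; split=> [[root [_ predP]]|[[x0] [chain dir]]].
  split; first by constructor.
  have rootle x : r root x.
    have [n] := ubnP (height r x); elim: n x => // n IH x; rewrite ltnS => hx.
    have [->//|/eqP /predP[p [[px _] _]]] := eqVneq x root.
    apply: rt (IH p _) _; last by case/andP: px.
    exact: leq_trans (height_lt rpo px) hx.
  split; last by move=> x y; exists root; rewrite !rootle.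
  move=> x y z; have [n] := ubnP (height r z).
  elim: n x y z => // n IH x y z; rewrite ltnS => hz xz yz.
  have [->|nxz] := eqVneq x z; first by rewrite yz orbT.
  have [->|nyz] := eqVneq y z; first by rewrite xz.
  have sxz : slt r x z by rewrite /slt nxz.
  have syz : slt r y z by rewrite /slt nyz.
  have [p pz xp] := exists_immediate_pred rpo sxz.
  have [q qz yq] := exists_immediate_pred rpo syz.
  have nz : z <> root.
    by move=> zr; move: nxz; rewrite (ra x z) ?eqxx // xz zr rootle.
  have [s [_ sU]] := predP z nz.
  have pq : p = q by rewrite -(sU p pz) -(sU q qz).
  rewrite -pq in yq; apply: IH xp yq.
  by apply: leq_trans hz; apply: height_lt => //; case: pz.
case: (arg_minnP (P := predT) (height r) (erefl : predT x0)) => root _ rmin.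
have rootle y : r root y.
  have [z /andP[zr zy]] := dir root y.
  have [<-//|nz] := eqVneq z root.
  have := rmin z isT; rewrite leqNgt => /negP[]; apply: height_lt => //.
  by rewrite /slt nz.
exists root; split=> [y|x nx].
  split=> [ymin|-> z]; last first.
    by apply/negP => /(height_lt rpo); rewrite ltnNge rmin.
  by have := ymin root; rewrite /slt rootle andbT negbK => /eqP.
have sx : slt r root x by rewrite /slt rootle eq_sym andbT; apply/eqP.
have [p pP _] := exists_immediate_pred rpo sx.
exists p; split=> // q qP; apply/eqP/negPn/negP => npq.
case: pP qP => [px pI] [qx qI].
have /andP[_ px'] := px; have /andP[_ qx'] := qx.
have /orP[pq|qp] := chain _ _ _ px' qx'.
  by have := pI q; rewrite qx /slt pq npq.
by have := qI p; rewrite px /slt qp eq_sym npq.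
Qed.

Lemma linear_extension r : partial_order r ->
  exists2 d, linear_order d & subrel r d.
Proof.
move=> rpo; have [rr ra rt] := rpo.
(* [height r] is strictly increasing; the rank breaks ties. *)
pose key x := height r x * #|X| + enum_rank x.
have keyI : injective key.
  move=> x y /(congr1 (modn^~ #|X|)); rewrite /key !modnMDl !modn_small //.
  by move/val_inj/enum_rank_inj.
exists (relpre key leq); first split=> /=.
- split=> [x|x y|y x z] /=; first exact: leqnn.
    by rewrite -eqn_leq => /eqP/keyI.
  exact: leq_trans.
- by move=> x y; apply: leq_total.
move=> x y xy /=; have [->|nxy] := eqVneq x y; first exact: leqnn.
have /(height_lt rpo) hxy : slt r x y by rewrite /slt nxy.
(* The tie-breaking rank is less than [#|X|], so it cannot outweigh a difference in height. *)
apply: leq_trans (leq_addr _ _); apply: leq_trans (_ : (height r x).+1 * #|X| <= _).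
  by rewrite mulSnr leq_add2l ltnW.
by rewrite leq_mul2r hxy orbT.
Qed.

Lemma slt_sub f e : reflexive e -> po_le f e <-> subrel f e.
Proof.
move=> er; split=> fe x y.
  have [->//|nxy fxy] := eqVneq x y.
  by have /andP[] : slt e x y by apply: fe; rewrite /slt nxy.
by case/andP=> nxy /fe exy; rewrite /slt nxy.
Qed.

Lemma eq_subrel f e : subrel f e -> subrel e f -> f = e.
Proof.
move=> fe ef; apply/funext => x; apply/funext => y.
by apply/idP/idP; [apply: fe|apply: ef].
Qed.

Lemma minimal_orderP (S : set (rel X)) e : (forall f, S f -> partial_order f) ->
  minimal_order S e <-> S e /\ forall f, S f -> subrel f e -> f = e.
Proof.
move=> Spo; split=> -[Se emin]; split=> // f Sf; have [er _ _] := Spo e Se.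
  by move/(slt_sub _ er); apply: emin.
by move/(slt_sub _ er); apply: emin.
Qed.

End FiniteOrders.

(** * Sides and edges of a principal decomposition *)

Section PrincipalDecomposition.
Variables (T : finType) (g : rel T) (P1 P2 : {set T}).
Hypothesis g_sym : symmetric g.
Hypothesis g_conn : forall x y, connect g x y.
Hypothesis decomp : principal_decomposition g P1 P2.
Local Notation V1 := {x : T | x \in P1}.
Implicit Types (d f : rel V1) (v w : V1) (e c : rel T).

Lemma P1F x : x \in P1 -> (x \in P2) = false.
Proof. by case: decomp => _ dis _ _; apply: disjointFr. Qed.

Variant side_spec (x : T) : Prop :=
  | InP1 v of x = val v
  | InP2 of x \in P2.

Lemma sideP x : side_spec x.
Proof.
case: decomp => /(_ x) /orP[x1|x2] _ _ _; last exact: InP2.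
exact: (@InP1 _ (Sub x x1)).
Qed.

Lemma edge_P1 v x : g (val v) x -> x \in P2.
Proof.
case: decomp => _ _ ind _ vx; have [w xw|//] := sideP x.
by move: (ind _ _ (valP v) (valP w)); rewrite -xw vx.
Qed.

Lemma edge_P2 x y : g x y -> x \in P2 -> exists2 w : V1, y = val w & g x (val w).
Proof.
case: decomp => _ _ _ ind xy x2; have [w yw|y2] := sideP y; first by exists w; rewrite -?yw.
by move: (ind _ _ x2 y2); rewrite xy.
Qed.

Lemma orientationP x y :
  reflect (exists v : V1, [/\ x = val v, y \in P2 & g (val v) y]) (orientation g P1 P2 x y).
Proof.
apply: (iffP and3P) => [[xy x1 y2]|[v [-> y2 vy]]]; last by split=> //; exact: valP.
by exists (Sub x x1).
Qed.

Lemma exists_edge x y : x != y -> exists z, g x z.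
Proof.
move=> nxy; have /connectP[[|z p] /=] := g_conn x y.
  by move=> _ yx; rewrite yx eqxx in nxy.
by case/andP=> xz _ _; exists z.
Qed.

(** Conditions (i) and (ii) of part 1, in a form that allows an empty [P1]. *)
Definition admissible f := [/\ partial_order f, tree_order f & Nbd_total g P2 f].

(** * Components of truncated graphs and their class orders *)

Lemma Gamma_vertexP d v w : linear_order d -> Gamma_vertex d v (val w) = d v w.
Proof.
move=> [[dr da _] dt]; rewrite /Gamma_vertex; apply/existsPn/idP => [nw|vw u].
  have := nw w; rewrite eqxx /= negb_and negbK => /orP[/eqP->//|].
  by have := dt v w => /orP[->|->].
rewrite negb_and; case: eqP => //= /val_inj ->; apply/negP => /andP[nwv wv].
by move: nwv; rewrite (da w v) ?eqxx // wv.
Qed.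

Lemma Gamma_vertex_P2 d v x : x \in P2 -> Gamma_vertex d v x.
Proof.
move=> x2; apply/existsPn => w; rewrite negb_and; case: eqP => // wx.
by move: x2; rewrite -wx P1F ?(valP w).
Qed.

Definition Gamma_edge d v : rel T :=
  fun a b => [&& g a b, Gamma_vertex d v a & Gamma_vertex d v b].

Lemma class_orderE d v w : class_order g d v w = connect (Gamma_edge d v) (val v) (val w).
Proof. by rewrite /class_order inE. Qed.

Lemma Gamma_edge_sym d v : connect_sym (Gamma_edge d v).
Proof.
by apply: sym_connect_sym => x y; rewrite /Gamma_edge g_sym [_ d v y && _]andbC.
Qed.

(** Raising [v] to [w] deletes more vertices, so connections at [w] persist at [v]. *)
Lemma Gamma_edge_le d v w : linear_order d -> d v w ->
  subrel (connect (Gamma_edge d w)) (connect (Gamma_edge d v)).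
Proof.
move=> dl vw; have [[_ _ dt] _] := dl.
apply: connect_sub => x y /and3P[xy xw yw]; apply: connect1.
have le z : Gamma_vertex d w z -> Gamma_vertex d v z.
  have [u ->|z2 _] := sideP z; last exact: Gamma_vertex_P2.
  by rewrite !Gamma_vertexP //; apply: dt.
by rewrite /Gamma_edge xy !le.
Qed.

(** The last vertex of a path in the truncated graph has not been deleted, so it is not strictly
    [d]-below [v]. *)
Lemma class_order_sub d : linear_order d -> subrel (class_order g d) d.
Proof.
move=> dl v w; rewrite class_orderE => /connectP[p].
case/lastP: p => [_ /val_inj ->|p z]; first by have [[dr _ _] _] := dl.
by rewrite last_rcons rcons_path => /andP[_ /and3P[_ _ Gz]] wz; rewrite -Gamma_vertexP // wz.
Qed.

Lemma class_order_admissible d : linear_order d -> admissible (class_order g d).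
Proof.
move=> dl; have [[dr da dt] dtot] := dl; split.
- split=> [v|v w /andP[vw wv]|w v u].
  + by rewrite class_orderE.
  + by apply: da; apply/andP; split; apply: class_order_sub.
  + move=> vw; have dvw := class_order_sub dl vw.
    move: vw; rewrite !class_orderE => vw /(Gamma_edge_le dl dvw).
    exact: connect_trans.
- split=> [x y z xz yz|x y].
    (* Since [a] is [d]-below [b], the path from [b] to [z] survives at [a] and joins the path from
       [a] to [z]. *)
    have chain a b : class_order g d a z -> class_order g d b z -> d a b -> class_order g d a b.
      rewrite !class_orderE => az bz ab; apply: connect_trans az _.
      by rewrite Gamma_edge_sym; apply: Gamma_edge_le bz.
    have /orP[xy|yx] := dtot x y; first by rewrite (chain x y).
    by rewrite (chain y x) ?orbT.
  (* Nothing is deleted at the [d]-least element [m], so its component is all of the connected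
     graph. *)
  case: (arg_minnP (P := predT) (height d) (erefl : predT x)) => m _ mmin.
  have dm u : d m u.
    have /orP[//|um] := dtot m u; have [->//|nmu] := eqVneq m u.
    have := mmin u isT; rewrite leqNgt => /negP[]; apply: height_lt => //.
    by rewrite /slt eq_sym nmu.
  have cm u : class_order g d m u.
    rewrite class_orderE; apply: connect_sub (g_conn (val m) (val u)) => a b ab.
    apply: connect1; rewrite /Gamma_edge ab.
    have G z : Gamma_vertex d m z.
      have [w ->|z2] := sideP z; last exact: Gamma_vertex_P2.
      by rewrite Gamma_vertexP.
    by rewrite !G.
  by exists m; rewrite !cm.
- move=> b b2 v w; rewrite !inE => bv bw.
  (* Two neighbours of [b] are joined through [b], which lies in [P2] and is never deleted. *)
  have nbr x y : g b (val x) -> g b (val y) -> d x y -> class_order g d x y.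
    move=> bx by' xy; rewrite class_orderE.
    apply: (connect_trans (y := b)); apply: connect1; rewrite /Gamma_edge.
      by rewrite g_sym bx Gamma_vertexP // dr Gamma_vertex_P2.
    by rewrite by' Gamma_vertexP // xy Gamma_vertex_P2.
  by have /orP[vw|wv] := dtot v w; [rewrite (nbr v w)|rewrite (nbr w v) ?orbT].
Qed.

Lemma class_order_least f d : admissible f -> linear_order d ->
  subrel f d ->
  subrel (class_order g d) f.
Proof.
move=> [[fr fa ft] [fchain _] ftot] dl fd v w; rewrite class_orderE => /connectP[p].
have [[_ da _] _] := dl.
(* Path invariant: a vertex of [P1] is itself [f]-above [v], and one of [P2] has a neighbour that
   is. *)
pose above x := exists2 u : V1, f v u & x = val u \/ (x \in P2 /\ g x (val u)).
suff path_above x : above x -> path (Gamma_edge d v) x p -> above (last x p).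
  move=> pp wp; have : above (val w).
    by rewrite wp; apply: path_above pp; exists v => //; left.
  by case=> u vu [/val_inj->//|[]]; rewrite P1F ?(valP w).
elim: p x => //= y p IH x [u vu xu] /andP[/and3P[xy _ Gy] yp]; apply: IH yp.
case: xu => [xu|[x2 xu]].
  rewrite xu in xy; exists u => //; right; split; last by rewrite g_sym.
  exact: edge_P1 xy.
have [z yz xz] := edge_P2 xy x2; exists z; last by left.
move: Gy; rewrite yz Gamma_vertexP // => vz.
(* The neighbours [u] and [z] of [x] are [f]-comparable. If [z] is below [u], then [v] and [z] are
   comparable too, and [z] below [v] forces [z = v], because [d] extends [f] and puts [v] below
   [z]. *)
have := ftot _ x2 u z; rewrite !inE => /(_ xu xz) /orP[uz|zu]; first exact: ft uz.
have /orP[//|zv] := fchain _ _ _ vu zu.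
by rewrite (da v z) // vz fd.
Qed.

Lemma admissible_class_order f : admissible f ->
  exists d, [/\ linear_order d, admissible (class_order g d) & subrel (class_order g d) f].
Proof.
move=> fA; have [fpo _ _] := fA; have [d dl fd] := linear_extension fpo.
by exists d; split=> //; [apply: class_order_admissible|apply: class_order_least].
Qed.

(** [d] extends [f] through the class order, so [class_order_least] gives the reverse inclusion. *)
Lemma class_order_minimal d f : linear_order d -> admissible f ->
  subrel f (class_order g d) -> f = class_order g d.
Proof.
move=> dl fA fd; apply: eq_subrel => //; apply: class_order_least => // x y /fd.
exact: class_order_sub.
Qed.

(** * Restriction to [P1] and lifting to [T] *)

Definition restrictP1 e : rel V1 := fun v w => e (val v) (val w).

Definition admissibleT e :=
  [/\ partial_order e, tree_order e, subrel (orientation g P1 P2) e & P2_incomparable P2 e].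

Lemma extendP d x y : reflect (exists v w : V1, [/\ x = val v, y = val w & d v w]) (extend d x y).
Proof.
apply: (iffP existsP) => [[v /existsP[w /and3P[/eqP xv /eqP yw vw]]]|[v [w [-> -> vw]]]].
  by exists v, w.
by exists v; apply/existsP; exists w; rewrite !eqxx.
Qed.

(** No generating relation starts in [P2], so a generating path is a chain of [d] followed by at
    most one oriented edge. *)
Lemma liftingP d x y : partial_order d ->
  reflect [\/ x = y, exists v w : V1, [/\ x = val v, y = val w & d v w]
           | exists v w : V1, [/\ x = val v, y \in P2, d v w & g y (val w)]]
    (lifting g P2 d x y).
Proof.
move=> [dr _ dt]; apply: (iffP idP); last first.
  case=> [->|[v [w [-> -> vw]]]|[v [w [-> y2 vw yw]]]].
  - exact: connect0.
  - by apply: connect1; apply/orP; left; apply/extendP; exists v, w.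
  - apply: (connect_trans (y := val w)); apply: connect1; apply/orP.
      by left; apply/extendP; exists v, w.
    by right; apply/orientationP; exists w; rewrite g_sym.
case/connectP=> p; elim: p x => [x _ ->|z p IH x /= /andP[xz zp]].
  by constructor 1.
move=> /(IH _ zp) {IH zp}.
case/orP: xz => [/extendP[v [w [-> -> vw]]]|/orientationP[v [-> z2 vz]]].
- case=> [<-|[v' [u [/val_inj <- -> wu]]]|[v' [u [/val_inj <- y2 wu yu]]]].
  + by constructor 2; exists v, w.
  + by constructor 2; exists v, u; split=> //; apply: dt wu.
  + by constructor 3; exists v, u; split=> //; apply: dt wu.
- case=> [<-|[v' [u [zE _ _]]]|[v' [u [zE _ _]]]].
  + by constructor 3; exists v, v; rewrite dr g_sym.
  + by move: z2; rewrite zE P1F ?(valP v').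
  + by move: z2; rewrite zE P1F ?(valP v').
Qed.

Lemma lifting_val d v w : partial_order d -> lifting g P2 d (val v) (val w) = d v w.
Proof.
move=> dpo; apply/liftingP/idP => //; last by move=> vw; constructor 2; exists v, w.
have [dr _ _] := dpo.
by case=> [/val_inj->//|[? [? [/val_inj-> /val_inj->]]]//|[? [? [_]]]]; rewrite P1F ?(valP w).
Qed.

Lemma restrict_admissible e : admissibleT e -> admissible (restrictP1 e).
Proof.
move=> [[er ea et] [echain edir] oe einc]; split.
- split=> [v|v w /ea /val_inj//|w v u]; [exact: er|exact: et].
- rewrite /restrictP1; split=> [x y z|x y]; first exact: echain.
  have [z /andP[zx zy]] := edir (val x) (val y).
  have [w zw|z2] := sideP z; first by exists w; rewrite -zw zx.
  (* A common lower bound in [P2] is replaced by a neighbour in [P1], which the orientation puts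
     below it. *)
  have nzx : z != val x by apply: contraTneq z2 => ->; rewrite P1F ?(valP x).
  have [a za] := exists_edge nzx; have [w _ zw] := edge_P2 za z2.
  have wz : e (val w) z by apply: oe; apply/orientationP; exists w; rewrite g_sym.
  by exists w; rewrite (et _ _ _ wz zx) (et _ _ _ wz zy).
(* Both neighbours are [e]-below [b], so the chain condition at [b] compares them. *)
- move=> b b2 v w; rewrite !inE => bv bw; apply: (echain _ _ b).
    by apply: oe; apply/orientationP; exists v; rewrite g_sym.
  by apply: oe; apply/orientationP; exists w; rewrite g_sym.
Qed.

Lemma lifting_admissible d : admissible d -> admissibleT (lifting g P2 d).
Proof.
move=> [dpo [dchain ddir] dtot]; have [dr da dt] := dpo.
have lift_trans : transitive (lifting g P2 d) by move=> y x z; apply: connect_trans.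
split.
- split=> // [x|x y /andP[xy yx]]; first exact: connect0.
  have [//|[v [w [xv yw vw]]]|[v [w [xv y2 _ _]]]] := liftingP x y dpo xy.
    by move: yx; rewrite xv yw lifting_val // => wv; rewrite (da v w) // vw.
  have [//|[v' [w' [yv _ _]]]|[v' [w' [yv _ _ _]]]] := liftingP y x dpo yx;
    by move: y2; rewrite yv P1F ?(valP v').
- split=> [x y z xz yz|x y].
    have [->|[v [w [xv zw vw]]]|[v [w [xv z2 vw zw]]]] := liftingP x z dpo xz.
    + by rewrite yz orbT.
    + have [->|[v' [w' [-> zw' vw']]]|[v' [w' [_ z2 _ _]]]] := liftingP y z dpo yz.
      * by rewrite xz.
      * have ww : w = w' by apply: val_inj; rewrite -zw.
        by rewrite xv !lifting_val //; apply: dchain vw _; rewrite ww.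
      * by move: z2; rewrite zw P1F ?(valP w).
    + have [->|[v' [w' [_ zw' _]]]|[v' [w' [-> _ vw' zw']]]] := liftingP y z dpo yz.
      * by apply/orP; left; apply/liftingP => //; constructor 3; exists v, w.
      * by move: z2; rewrite zw' P1F ?(valP w').
      * rewrite xv !lifting_val //.
        (* The neighbours [w] and [w'] of [z] are comparable; [v] and [v'] both lie below the larger
           one. *)
        have := dtot z z2 w w'; rewrite !inE => /(_ zw zw') /orP[ww|ww].
          exact: (dchain _ _ _ (dt _ _ _ vw ww) vw').
        exact: (dchain _ _ _ vw (dt _ _ _ vw' ww)).
  (* Treating [x = y] apart covers a tree with a single vertex, which may lie in [P2] and has no
     neighbour. *)
  have [->|nxy] := eqVneq x y; first by exists y; rewrite /lifting connect0.
  have below z z' : z != z' -> exists v : V1, lifting g P2 d (val v) z.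
    move=> nz; have [v ->|z2] := sideP z; first by exists v; apply: connect0.
    have [a za] := exists_edge nz; have [w _ zw] := edge_P2 za z2.
    by exists w; apply/liftingP => //; constructor 3; exists w, w.
  have [v vx] := below x y nxy; have [|w wy] := below y x; first by rewrite eq_sym.
  have [u /andP[uv uw]] := ddir v w; exists (val u).
  by rewrite !(lift_trans _ _ _ _ vx, lift_trans _ _ _ _ wy) ?lifting_val.
- by move=> x y xy; apply: connect1; rewrite xy orbT.
- move=> x y x2 y2 nxy; apply/negP => xy.
  have [yx|[v [w [xv _ _]]]|[v [w [xv _ _ _]]]] := liftingP x y dpo xy.
  + by rewrite yx eqxx in nxy.
  + by move: x2; rewrite xv P1F ?(valP v).
  + by move: x2; rewrite xv P1F ?(valP v).
Qed.

Lemma lifting_sub d e : reflexive e -> transitive e ->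
  subrel (orientation g P1 P2) e -> subrel d (restrictP1 e) ->
  subrel (lifting g P2 d) e.
Proof.
move=> er et oe de x y /connectP[p].
elim: p x => [x _ ->|z p IH x /= /andP[xz zp] /(IH _ zp)]; first exact: er.
by apply: et; case/orP: xz => [/extendP[v [w [-> -> /de]]]|/oe].
Qed.

(** * Minimal orders and their linear extensions *)

Lemma tOrdP_E : (0 < #|T|) -> tOrdP g P1 P2 =
  [set e | admissibleT e /\ forall e', admissibleT e' -> subrel e' e -> e' = e]%classic.
Proof.
case/card_gt0P => x0 _; rewrite /tOrdP.
set S := (X in minimal_order X).
have SE : S = [set e | admissibleT e]%classic.
  apply/funext => e; apply/propext; rewrite /S /=; split.
    move=> [epo /(rooted_treeP epo)[_ etree] oe inc]; split=> // x y /oe.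
    by case/andP.
  move=> [epo etree oe inc]; split=> //.
    by apply/(rooted_treeP epo); split=> //; constructor.
  move=> a b ab; rewrite /slt oe // andbT; case/and3P: ab => _ a1 b2.
  by apply: contraTneq b2 => <-; rewrite P1F.
rewrite SE; apply/funext => e; apply/propext; apply: minimal_orderP => f.
by case.
Qed.

(** Nonemptiness of [P1] provides the root; the class order found below a minimal order must equal
    it. *)
Lemma tOrd_E : (0 < #|P1|) -> tOrd g P1 =
  [set d | minimal_order
    [set f | [/\ partial_order f, rooted_tree f & Nbd_total g P2 f]]%classic d]%classic.
Proof.
case/card_gt0P => x0 x01; set S := (X in minimal_order X).
have SE : S = [set f | admissible f]%classic.
  apply/funext => f; apply/propext; rewrite /S /=; split=> -[fpo].
    by move/(rooted_treeP fpo) => -[_ ftree] ftot; split.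
  move=> ftree ftot; split=> //; apply/(rooted_treeP fpo); split=> //.
  by constructor; exists x0.
rewrite SE; apply/funext => f; apply/propext; split; last first.
  case/minimal_orderP => [h [//]|fA fmin].
  have [d [dl cA cf]] := admissible_class_order fA.
  by exists d => //; apply: fmin.
case=> d dl <-; apply/minimal_orderP => [h [//]|]; split.
  exact: class_order_admissible.
by move=> h hA; apply: class_order_minimal.
Qed.

(** An admissible order below the lifting restricts to one below the class order, hence to the class
    order itself, and so contains its lifting. *)
Lemma lifting_class_order_tOrdP d : 0 < #|T| -> linear_order d ->
  tOrdP g P1 P2 (lifting g P2 (class_order g d)).
Proof.
move=> T0 dl; have cA := class_order_admissible dl; have [cpo _ _] := cA.
rewrite tOrdP_E //; split=> [|f fA fd]; first exact: lifting_admissible.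
have [[fr _ ft] _ of_ _] := fA.
apply: eq_subrel => //; apply: lifting_sub => //.
suff <- : restrictP1 f = class_order g d by [].
apply: class_order_minimal => //; first exact: restrict_admissible.
by move=> v w /fd; rewrite lifting_val.
Qed.

(** The class order lies below the restriction of [e], so its lifting lies below [e], and minimality
    of [e] gives equality. *)
Lemma tOrdP_lifting e d : 0 < #|T| -> tOrdP g P1 P2 e -> linear_order d ->
  subrel (restrictP1 e) d -> e = lifting g P2 (class_order g d).
Proof.
move=> T0; rewrite tOrdP_E // => -[eA emin] dl ed; apply/esym/emin.
  by apply/lifting_admissible/class_order_admissible.
have [[er _ et] _ oe _] := eA.
by apply: lifting_sub => //; apply: class_order_least => //; apply: restrict_admissible.
Qed.

Lemma restrict_linear c : linear_order c -> linear_order (restrictP1 c).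
Proof.
move=> [[cr ca ct] ctot]; split; last by move=> v w; apply: ctot.
by split=> [v|v w /ca /val_inj//|w v u]; [exact: cr|exact: ct].
Qed.

Lemma SigmaP e c : Sigma e c <-> linear_order c /\ subrel e c.
Proof.
split=> -[cl ec]; split=> //; have [[cr _ _] _] := cl.
  by apply/(slt_sub _ cr).
by move=> x y; move: x y; apply/(slt_sub _ cr).
Qed.

(** The right-hand side depends on [c] only, so distinct minimal orders share no linear
    extension. *)
Lemma Sigma_tOrdP e c : 0 < #|T| -> tOrdP g P1 P2 e -> Sigma e c ->
  e = lifting g P2 (class_order g (restrictP1 c)).
Proof.
move=> T0 eO /SigmaP[cl ec]; apply: tOrdP_lifting => //; first exact: restrict_linear.
by move=> v w; apply: ec.
Qed.

End PrincipalDecomposition.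

Theorem theorem5p1 (T : finType) (g : rel T) (P1 P2 : {set T}) :
  is_tree g -> principal_decomposition g P1 P2 ->
  [/\ (0 < #|P1| ->
        tOrd g P1 =
        [set d | minimal_order
          [set f | [/\ partial_order f, rooted_tree f & Nbd_total g P2 f]]%classic d]%classic),
      set_bij (tOrd g P1) (tOrdP g P1 P2) (fun d => lifting g P2 d)
    & Sigma (connect (orientation g P1 P2)) =
        (\bigcup_(e in tOrdP g P1 P2) Sigma e)%classic /\
      trivIset (tOrdP g P1 P2) (@Sigma T)].
Proof.
move=> [gs _ T0 gc _] dec; split; first exact: tOrd_E.
- split.
  + by move=> _ [d dl <-]; apply: lifting_class_order_tOrdP.
  + move=> _ _ /set_mem[d dl <-] /set_mem[d' dl' <-] eqL.
    have [cpo _ _] := class_order_admissible gs gc dec dl.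
    have [cpo' _ _] := class_order_admissible gs gc dec dl'.
    apply/funext => v; apply/funext => w.
    (* Restriction to [P1] undoes the lifting, whence injectivity. *)
    by rewrite -(lifting_val gs dec v w cpo) eqL lifting_val.
  + move=> e eO; have := eO; rewrite tOrdP_E // => -[eA _].
    have [rpo _ _] := restrict_admissible gs gc dec eA.
    have [d dl ed] := linear_extension rpo.
    exists (class_order g d); first by exists d.
    by apply/esym/tOrdP_lifting.
- split; last first.
    move=> e e' eO eO' [c [ce ce']].
    by rewrite (Sigma_tOrdP gs gc dec T0 eO ce) -(Sigma_tOrdP gs gc dec T0 eO' ce').
  apply/seteqP; split=> c.
    move=> /SigmaP[cl oc]; have rl := restrict_linear P1 cl.
    have [[cr _ ct] _] := cl.
    (* [c] contains both generating relations of this lifting, hence extends it. *)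
    exists (lifting g P2 (class_order g (restrictP1 (P1 := P1) c))).
      exact: lifting_class_order_tOrdP.
    apply/SigmaP; split=> //; apply: lifting_sub => //.
      by move=> x y /connect1/oc.
    exact: class_order_sub.
  case=> e eO /SigmaP[cl ec]; apply/SigmaP; split=> // x y /connectP[p].
  have [[cr _ ct] _] := cl; move: eO; rewrite tOrdP_E // => -[[_ _ oe _] _].
  (* [c] contains the oriented edges through [e], hence by transitivity their closure. *)
  elim: p x => [x _ ->|z p IH x /= /andP[xz zp] /(IH _ zp)]; first exact: cr.
  by apply: ct; apply/ec/oe.
Qed.
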